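(* Let $M$ be a graded module of formal vector fields as in the context, and let $X=X_0+\cdots\in M$ be a vector field whose initial part $X_0$ is quasi-homogeneous of degree $\delta_0$. Put $B_K^1=\{[X_0,Z] : Z\in M\}$ and $A_K^1=B_K^1+\widehat{\mathcal O}_n X_0$, and let $W$ be a complement of $A_K^1$ in $M$. Then there exist a vector field $Y$ belonging to $W$, a formal diffeomorphism $\Phi$ and a formal unit $u$ such that $$\Phi^*X=u\,(X_0+Y).$$
   Context: Let $p=(p_1,\dots,p_n)$ be fixed relatively prime positive integers and $R=\sum_i p_i x_i\,\partial/\partial x_i$. A polynomial vector field $Z$ is quasi-homogeneous of degree $k$ if $[R,Z]=kZ$ (so $x^m\partial/\partial x_i$ has degree $\sum_j p_jm_j-p_i$). $\widehat{\mathcal O}_n=\mathbb C[[x_1,\dots,x_n]]$; a formal unit is an element $u\in\widehat{\mathcal O}_n$ with $u(0)\neq0$. $M$ is an $\widehat{\mathcal O}_n$-submodule of the module of formal vector fields, graded by the quasi-homogeneity degree, $M=\oplus_k M_k$, where $M_k$ consists of the elements of $M$ that are quasi-homogeneous of degree $k$. The operator $d^0=\mathrm{ad}_{X_0}=[X_0,\cdot]$ is considered as an operator $M\to M$, and $B_K^1$ is its image. $X=X_0+\cdots$ means that the remaining terms of $X$ have quasi-homogeneity degree greater than that of $X_0$. $\Phi^*X=(D\Phi)^{-1}\cdot (X\circ\Phi)$ denotes the pull-back.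
   Formalization: The module M is assumed stable under ad_V for every quasi-homogeneous V in M (not only under ad_{X_0}), and the complement W is assumed graded; without either assumption the statement has counterexamples. *)

(* Defs.v *)
From HB Require Import structures.
From mathcomp Require Import all_boot all_order all_algebra.
From mathcomp Require Import boolp classical_sets reals complex.
From mathcomp Require Import mpoly.

Set Implicit Arguments.
Unset Strict Implicit.
Unset Printing Implicit Defensive.

Import GRing.Theory.

Local Open Scope ring_scope.

(** * Formal power series in n variables

    [f : fps K n] is the series sum_m (f m) x^m, where m ranges over the
    multi-indices ['X_{1..n}]. *)

Record fps (K : fieldType) (n : nat) := Fps { fcoef :> 'X_{1..n} -> K }.

Section FpsRing.

Variables (K : fieldType) (n : nat).
Implicit Types (f g h : fps K n) (m : 'X_{1..n}).

HB.instance Definition _ := gen_eqMixin (fps K n).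
HB.instance Definition _ := gen_choiceMixin (fps K n).

Lemma fpsP f g : (forall m, f m = g m) -> f = g.
Proof. by case: f g => [f] [g] /= /funext ->. Qed.

Definition fpsC (c : K) : fps K n := Fps (fun m => if m == 0%MM then c else 0).
Definition fps_add f g : fps K n := Fps (fun m => f m + g m).
Definition fps_opp f : fps K n := Fps (fun m => - f m).
(* The index type bounds both degrees by mdeg m, which only serves to make the
   Cauchy sum a finite one. *)
Definition fps_mul f g : fps K n :=
  Fps (fun m => \sum_(k : 'X_{1..n < (mdeg m).+1, (mdeg m).+1}
                     | m == (k.1 + k.2)%MM) f k.1 * g k.2).

Definition fps_trunc d f : {mpoly K[n]} :=
  \sum_(m : 'X_{1..n < d}) f m *: 'X_[m].

Lemma mcoeff_trunc d f m : (mdeg m < d)%N -> (fps_trunc d f)@_m = f m.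
Proof.
move=> lt_md; rewrite /fps_trunc raddf_sum /=.
rewrite (bigD1 (BMultinom lt_md)) //= mcoeffZ mcoeffX eqxx mulr1.
rewrite big1 ?addr0 // => k; rewrite bmeqP /= => /negPf ne.
by rewrite mcoeffZ mcoeffX ne mulr0.
Qed.

Lemma fps_mul_mpoly f g (p q : {mpoly K[n]}) m :
  (forall k, (mdeg k <= mdeg m)%N -> p@_k = f k) ->
  (forall k, (mdeg k <= mdeg m)%N -> q@_k = g k) ->
  fps_mul f g m = (p * q)@_m.
Proof.
move=> pf qg; rewrite mcoeffM; apply: eq_bigr => -[[k1 lt1] [k2 lt2]] /= _.
by rewrite pf ?qg.
Qed.

Lemma fps_mul_trunc d f g m : (mdeg m < d)%N ->
  fps_mul f g m = (fps_trunc d f * fps_trunc d g)@_m.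
Proof.
by move=> lt_md; apply: fps_mul_mpoly => k lek;
  rewrite mcoeff_trunc // (leq_ltn_trans lek).
Qed.

Fact fps_addA : associative fps_add.
Proof. by move=> f g h; apply: fpsP => m /=; rewrite addrA. Qed.
Fact fps_addC : commutative fps_add.
Proof. by move=> f g; apply: fpsP => m /=; rewrite addrC. Qed.
Fact fps_add0 : left_id (fpsC 0) fps_add.
Proof. by move=> f; apply: fpsP => m /=; rewrite if_same add0r. Qed.
Fact fps_addN : left_inverse (fpsC 0) fps_opp fps_add.
Proof. by move=> f; apply: fpsP => m /=; rewrite if_same addNr. Qed.

HB.instance Definition _ := GRing.isZmodule.Build (fps K n)
  fps_addA fps_addC fps_add0 fps_addN.

Fact fps_mulA : associative fps_mul.
Proof.
move=> f g h; apply: fpsP => m; set d := (mdeg m).+1.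
rewrite (@fps_mul_mpoly _ _ (fps_trunc d f) (fps_trunc d g * fps_trunc d h)).
- rewrite (@fps_mul_mpoly _ _ (fps_trunc d f * fps_trunc d g) (fps_trunc d h)).
  + by rewrite mulrA.
  + by move=> k lek; rewrite -fps_mul_trunc.
  + by move=> k lek; rewrite mcoeff_trunc.
- by move=> k lek; rewrite mcoeff_trunc.
- by move=> k lek; rewrite -fps_mul_trunc.
Qed.

Fact fps_mulC : commutative fps_mul.
Proof.
by move=> f g; apply: fpsP => m; rewrite !(fps_mul_trunc _ _ (ltnSn _)) mulrC.
Qed.

Fact fps_mul1 : left_id (fpsC 1) fps_mul.
Proof.
move=> f; apply: fpsP => m.
rewrite (@fps_mul_mpoly _ _ 1 (fps_trunc (mdeg m).+1 f)).
- by rewrite mul1r mcoeff_trunc.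
- by move=> k _; rewrite mcoeff1 /=; case: eqP.
- by move=> k lek; rewrite mcoeff_trunc.
Qed.

Fact fps_mulDl : left_distributive fps_mul fps_add.
Proof.
move=> f g h; apply: fpsP => m /=.
by rewrite -big_split /=; apply: eq_bigr => k _; rewrite mulrDl.
Qed.

Fact fps_1_neq0 : fpsC 1 != 0.
Proof.
apply/eqP => /(congr1 (fun f : fps K n => f 0%MM)) /=.
by rewrite eqxx => /eqP; rewrite oner_eq0.
Qed.

HB.instance Definition _ := GRing.Zmodule_isComNzRing.Build (fps K n)
  fps_mulA fps_mulC fps_mul1 fps_mulDl fps_1_neq0.

Lemma coef_fps0 m : (0 : fps K n) m = 0.
Proof. by rewrite /= if_same. Qed.
Lemma coef_fps1 m : (1 : fps K n) m = if m == 0%MM then 1 else 0.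
Proof. by []. Qed.
Lemma coef_fpsD f g m : (f + g) m = f m + g m. Proof. by []. Qed.
Lemma coef_fpsN f m : (- f) m = - f m. Proof. by []. Qed.
Lemma coef_fpsM f g m : (f * g) m = fps_mul f g m. Proof. by []. Qed.
Lemma coef_fps_sum I (r : seq I) (P : pred I) (F : I -> fps K n) m :
  (\sum_(i <- r | P i) F i) m = \sum_(i <- r | P i) F i m.
Proof.
apply: (big_morph (fun f : fps K n => f m) (op1 := +%R) (id1 := 0)) => //.
exact: coef_fps0.
Qed.

Lemma coef_fpsM0 f g : (f * g) 0%MM = f 0%MM * g 0%MM.
Proof.
rewrite coef_fpsM (@fps_mul_trunc 1) ?mdeg0 //.
by rewrite (rmorphM (mcoeff 0%MM)) /= !mcoeff_trunc ?mdeg0.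
Qed.

Lemma coef_fpsX_small f k m :
  f 0%MM = 0 -> (mdeg m < k)%N -> (f ^+ k) m = 0.
Proof.
move=> f0; elim: k m => // k IH m lt_mk.
rewrite exprS coef_fpsM /= big1 // => -[[a lta] [b ltb]] /= /eqP em.
have [->|nz] := eqVneq a 0%MM; first by rewrite f0 mul0r.
rewrite IH ?mulr0 //; move: lt_mk; rewrite em mdegD ltnS.
by apply: leq_trans; rewrite -[X in (X < _)%N]add0n ltn_add2r lt0n mdeg_eq0.
Qed.

(* Geometric series: with h = 1 - f/f(0), the terms h^k with k > mdeg m do not
   contribute to the coefficient of x^m. *)
Definition fps_inv f : fps K n :=
  if f 0%MM == 0 then f else
  Fps (fun m => (f 0%MM)^-1 *
    \sum_(k < (mdeg m).+1) ((1 - fpsC (f 0%MM)^-1 * f) ^+ k) m).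

Definition fps_unit : pred (fps K n) := fun f => f 0%MM != 0.

Lemma coef_fpsCM c f m : (fpsC c * f) m = c * f m.
Proof.
rewrite coef_fpsM (@fps_mul_mpoly _ _ c%:MP (fps_trunc (mdeg m).+1 f)).
- by rewrite mcoeffCM mcoeff_trunc.
- by move=> k _; rewrite mcoeffC /= eq_sym; case: eqP; rewrite ?mulr1 ?mulr0.
- by move=> k lek; rewrite mcoeff_trunc.
Qed.

Lemma fpsCM c d : fpsC (c * d) = fpsC c * fpsC d.
Proof.
by apply: fpsP => m; rewrite coef_fpsCM /=; case: eqP; rewrite ?mulr0.
Qed.

Fact fps_mulVr : {in fps_unit, left_inverse 1 fps_inv *%R}.
Proof.
move=> f; rewrite unfold_in => /[dup] f0 /negPf f0F.
apply: fpsP => m; set h := 1 - fpsC (f 0%MM)^-1 * f.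
have h0 : h 0%MM = 0.
  rewrite coef_fpsD coef_fpsN coef_fpsCM mulVf //.
  by rewrite coef_fps1 eqxx subrr.
pose g := fpsC (f 0%MM)^-1 * \sum_(k < (mdeg m).+1) h ^+ k.
have gE a : (mdeg a < (mdeg m).+1)%N -> fps_inv f a = g a.
  move=> lta; rewrite /g coef_fpsCM coef_fps_sum /fps_inv f0F /=.
  congr (_ * _); rewrite -!(big_mkord xpredT (fun k => (h ^+ k) a)).
  rewrite [RHS](big_cat_nat (n := (mdeg a).+1)) //=.
  rewrite [X in _ = _ + X]big1_seq ?addr0 // => k.
  rewrite mem_index_iota => /andP[_ /andP[lt_ak _]].
  exact: coef_fpsX_small.
have -> : (fps_inv f * f) m = (g * f) m.
  by apply: eq_bigr => -[[a lta] b] _; rewrite /= -/g gE.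
have -> : g * f = 1 - h ^+ (mdeg m).+1.
  rewrite /g mulrAC.
  have -> : fpsC (f 0%MM)^-1 * f = 1 - h by rewrite /h subKr.
  by rewrite -opprB mulNr -subrX1 opprB.
by rewrite coef_fpsD coef_fpsN coef_fpsX_small // subr0.
Qed.

Fact fps_unitP f g : g * f = 1 -> fps_unit f.
Proof.
move=> /(congr1 (fun f : fps K n => f 0%MM)); rewrite coef_fpsM0 => e.
apply/eqP => f0; move: e; rewrite f0 mulr0 /= eqxx => /esym/eqP.
by rewrite oner_eq0.
Qed.

Fact fps_inv_out : {in [predC fps_unit], fps_inv =1 id}.
Proof. by move=> f; rewrite !inE negbK /fps_inv => ->. Qed.

HB.instance Definition _ := GRing.ComNzRing_hasMulInverse.Build (fps K n)
  fps_mulVr fps_unitP fps_inv_out.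

End FpsRing.

Arguments fpsC {K n} c.

(** * Formal vector fields and formal maps *)

Section VectorFields.

Variables (K : fieldType) (n : nat).

(* Z stands for sum_i Z_i d/dx_i with Z_i = Z i 0; the same type also carries
   formal maps (K^n, 0) -> (K^n, 0). *)
Definition vfield := 'cV[fps K n]_n.

Definition fps_deriv (j : 'I_n) (f : fps K n) : fps K n :=
  Fps (fun m => f (m + U_(j))%MM *+ (m j).+1).

Definition jacobian (Z : vfield) : 'M[fps K n]_n :=
  \matrix_(i, j) fps_deriv j (Z i 0).

(* [V, Z]_i = V(Z_i) - Z(V_i) *)
Definition lie (V Z : vfield) : vfield :=
  jacobian Z *m V - jacobian V *m Z.

(* f o Phi = sum_a f_a Phi^a. Meaningful when Phi(0) = 0: then Phi^a has order
   at least mdeg a, so that only mdeg a <= mdeg m matters at x^m. *)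
Definition fps_comp (f : fps K n) (Phi : vfield) : fps K n :=
  Fps (fun m => \sum_(a : 'X_{1..n < (mdeg m).+1})
                   f a * (\prod_(i < n) Phi i 0 ^+ (a i)) m).

Definition formal_diffeo (Phi : vfield) : Prop :=
  (forall i, Phi i 0 0%MM = 0) /\
  \matrix_(i, j) (jacobian Phi i j 0%MM) \in unitmx.

Definition pullback (Phi X : vfield) : vfield :=
  invmx (jacobian Phi) *m (\col_i fps_comp (X i 0) Phi).

Definition formal_unit (u : fps K n) : Prop := u 0%MM != 0.

(** ** Quasi-homogeneity *)

Variable p : 'I_n -> nat.

Definition euler : vfield :=
  \col_i Fps (fun m => if m == U_(i)%MM then (p i)%:R else 0).

Definition qhom (k : int) (Z : vfield) : Prop := lie euler Z = Z *~ k.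

(* The quasi-homogeneous part of degree k: the terms x^m d/dx_i of Z with
   sum_j p_j m_j - p_i = k. *)
Definition qpart (k : int) (Z : vfield) : vfield :=
  \col_i Fps (fun m =>
    if (\sum_(j < n) p j * m j)%N%:Z - (p i)%:Z == k then Z i 0 m else 0).

(* S = (+)_k S_k for a set S of formal vector fields: S consists of the formal
   sums, possibly infinite, of elements of the S_k. *)
Definition graded (S : set vfield) : Prop :=
  forall Z, S Z <-> forall k, S (qpart k Z).

Definition submodule (S : set vfield) : Prop :=
  S 0 /\ forall (f : fps K n) Z Z', S Z -> S Z' -> S (f *: Z + Z').

Definition subspace (S : set vfield) : Prop :=
  S 0 /\ forall (c : K) Z Z', S Z -> S Z' -> S (fpsC c *: Z + Z').

(* ad_V maps M to M for every quasi-homogeneous V in M, that is, for every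
   possible initial part of an element of M. Stability under a single ad_{X_0}
   does not keep the normalizing transformations inside M. *)
Definition ad_stable (M : set vfield) : Prop :=
  forall k V, M V -> qhom k V -> forall Z, M Z -> M (lie V Z).

Definition B1 (M : set vfield) (X0 : vfield) : set vfield :=
  [set lie X0 Z | Z in M]%classic.

Definition A1 (M : set vfield) (X0 : vfield) : set vfield :=
  [set b + f *: X0 | b in B1 M X0 & f in setT]%classic.

(* Complements are taken in the category of graded vector spaces: the
   W-component of an element of degree > d then also has degree > d. *)
Definition graded_complement (M A W : set vfield) : Prop :=
  [/\ subspace W, graded W,
      (A `&` W = [set 0])%classic &
      ([set a + w | a in A & w in W] = M)%classic].

Definition initial_part (d : int) (X0 X : vfield) : Prop :=
  qhom d X0 /\ forall k : int, k <= d -> qpart k (X - X0) = 0.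

End VectorFields.

(* Main.v *)
Require Import Defs.
From mathcomp Require Import all_boot all_order all_algebra.
From mathcomp Require Import boolp classical_sets reals complex.
From mathcomp Require Import mpoly zify ring.

(* A single formal vector field Z in M, all of whose terms have positive
   degree, normalizes X: its time-one flow Phi, given by Phi_i = exp(Z) x_i,
   satisfies f o Phi = exp(Z) f for every series f, whence
   Phi^* X = exp(ad_Z) X. The equation exp(ad_Z) X = u (X_0 + Y) is solved for
   (Z, u, Y) degree by degree. Adding to Z, u and Y terms zeta, g and y of degree
   c, c and delta_0 + c changes the degree delta_0 + c part of the difference of
   the two sides by -[X_0, zeta] - g X_0 - y and leaves the lower degrees alone,
   so M = [X_0, M] + O X_0 + W provides the correction. Since ad_Z maps M to M,
   the difference never leaves M. *)

Set Implicit Arguments.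
Unset Strict Implicit.
Unset Printing Implicit Defensive.

Import Order.TTheory GRing.Theory Num.Theory.

Local Open Scope ring_scope.

(** * Derivations of formal power series and the Lie bracket *)

Section Derivations.

Variables (K : fieldType) (n : nat).
Implicit Types (f g : fps K n) (V Z : vfield K n).

Lemma fps_derivD j f g : fps_deriv j (f + g) = fps_deriv j f + fps_deriv j g.
Proof. by apply: fpsP => m; rewrite /= mulrnDl. Qed.

Lemma fps_derivN j f : fps_deriv j (- f) = - fps_deriv j f.
Proof. by apply: fpsP => m; rewrite /= mulNrn. Qed.

Lemma fps_derivC j c : fps_deriv j (fpsC c : fps K n) = 0.
Proof.
apply: fpsP => m /=; rewrite mnmD_eq0 [(U_(j) == 0)%MM]negbTE ?andbF ?if_same ?mul0rn //.
by apply/eqP => /mnmP/(_ j); rewrite mnm1E mnm0E eqxx.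
Qed.

Lemma fps_derivM j f g :
  fps_deriv j (f * g) = fps_deriv j f * g + f * fps_deriv j g.
Proof.
(* The derivative reads coefficients one degree above [m], so truncating at [(mdeg m).+2] keeps all
   that contributes and reduces the rule to polynomials. *)
apply: fpsP => m; set d := (mdeg m).+2.
have dE h k : (mdeg k <= mdeg m)%N -> (fps_trunc d h)^`M(j)@_k = fps_deriv j h k.
  by move=> lek; rewrite mcoeff_deriv mcoeff_trunc // mdegD mdeg1 addn1 !ltnS.
have tE h k : (mdeg k <= mdeg m)%N -> (fps_trunc d h)@_k = h k.
  by move=> lek; rewrite mcoeff_trunc // ltnS leqW.
have -> : fps_deriv j (f * g) m = fps_mul f g (m + U_(j))%MM *+ (m j).+1 by [].
rewrite (fps_mul_trunc (d := d)) ?mdegD ?mdeg1 ?addn1 //.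
rewrite -mcoeff_deriv mderivM mcoeffD coef_fpsD !coef_fpsM.
rewrite (fps_mul_mpoly (p := (fps_trunc d f)^`M(j)) (q := fps_trunc d g));
  [|exact: dE|exact: tE].
by rewrite (fps_mul_mpoly (p := fps_trunc d f) (q := (fps_trunc d g)^`M(j)));
  [|exact: tE|exact: dE].
Qed.

Lemma fps_deriv_comm i j f :
  fps_deriv i (fps_deriv j f) = fps_deriv j (fps_deriv i f).
Proof.
apply: fpsP => m /=; rewrite !mnmDE !mnm1E -!mulrnA -!addmA [(U_(j) + _)%MM]addmC.
by case: eqVneq => [->|]; rewrite ?eqxx // !addn0 mulnC.
Qed.

Definition vder V f : fps K n := \sum_j V j 0 * fps_deriv j f.

Lemma lieE V Z i : lie V Z i 0 = vder V (Z i 0) - vder Z (V i 0).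
Proof.
rewrite !mxE; congr (_ - _); apply: eq_bigr => j _; by rewrite !mxE mulrC.
Qed.

Lemma vderD V : {morph vder V : f g / f + g}.
Proof.
move=> f g; rewrite -big_split; apply: eq_bigr => j _ /=.
by rewrite fps_derivD mulrDr.
Qed.

Lemma vderN V : {morph vder V : f / - f}.
Proof.
by move=> f; rewrite -sumrN; apply: eq_bigr => j _; rewrite fps_derivN mulrN.
Qed.

Lemma vderB V : {morph vder V : f g / f - g}.
Proof. by move=> f g; rewrite vderD vderN. Qed.

Lemma vder0 V : vder V 0 = 0.
Proof. by rewrite -[in LHS](subrr 0) vderB subrr. Qed.

Lemma vder_sum V I (r : seq I) (P : pred I) (F : I -> fps K n) :
  vder V (\sum_(i <- r | P i) F i) = \sum_(i <- r | P i) vder V (F i).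
Proof. exact: (big_morph _ (vderD V) (vder0 V)). Qed.

Lemma vderM V f g : vder V (f * g) = vder V f * g + f * vder V g.
Proof.
rewrite /vder mulr_suml mulr_sumr -big_split /=; apply: eq_bigr => j _.
by rewrite fps_derivM mulrDr mulrA mulrCA.
Qed.

Lemma vderC V c : vder V (fpsC c) = 0.
Proof. by rewrite /vder big1 // => j _; rewrite fps_derivC mulr0. Qed.

Lemma vderCM V c f : vder V (fpsC c * f) = fpsC c * vder V f.
Proof. by rewrite vderM vderC mul0r add0r. Qed.

Lemma vderDl V Z f : vder (V + Z) f = vder V f + vder Z f.
Proof.
by rewrite -big_split; apply: eq_bigr => j _; rewrite mxE mulrDl.
Qed.

Lemma vderNl V f : vder (- V) f = - vder V f.
Proof. by rewrite -sumrN; apply: eq_bigr => j _; rewrite mxE mulNr. Qed.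

Lemma vderZl h V f : vder (h *: V) f = h * vder V f.
Proof. by rewrite mulr_sumr; apply: eq_bigr => j _; rewrite mxE mulrA. Qed.

(** Partial derivatives commute, so the second-order terms of the two compositions cancel; the
    first-order terms are those of the bracket. *)
Lemma vder_lie V Z f : vder (lie V Z) f = vder V (vder Z f) - vder Z (vder V f).
Proof.
have vder2 (A B : vfield K n) : vder A (vder B f) =
    \sum_i vder A (B i 0) * fps_deriv i f
    + \sum_i \sum_j B i 0 * (A j 0 * fps_deriv j (fps_deriv i f)).
  rewrite {2}/vder vder_sum -big_split; apply: eq_bigr => i _ /=.
  by rewrite vderM mulr_sumr.
rewrite !vder2 opprD addrACA -sumrB [X in _ + (_ - X)]exchange_big /=.
rewrite [X in _ + X](_ : _ = 0) ?addr0; last first.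
  apply/eqP; rewrite subr_eq0; apply/eqP.
  apply: eq_bigr => i _; apply: eq_bigr => j _.
  by rewrite fps_deriv_comm mulrCA.
by apply: eq_bigr => i _; rewrite lieE mulrBl.
Qed.

Lemma vfieldP V Z : (forall i, V i 0 = Z i 0) -> V = Z.
Proof. by move=> e; apply/matrixP => i j; rewrite ord1. Qed.

Lemma vfieldDE V Z i : (V + Z) i 0 = V i 0 + Z i 0.
Proof. exact: mxE. Qed.

Lemma vfieldNE V i : (- V) i 0 = - V i 0.
Proof. exact: mxE. Qed.

Lemma vfieldZE f V i : (f *: V) i 0 = f * V i 0.
Proof. exact: mxE. Qed.

Lemma lieC V Z : lie V Z = - lie Z V.
Proof. by apply: vfieldP => i; rewrite [RHS]vfieldNE !lieE opprB. Qed.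

Lemma lieDr V Z Z' : lie V (Z + Z') = lie V Z + lie V Z'.
Proof.
apply: vfieldP => i; rewrite [RHS]vfieldDE !lieE vfieldDE vderD vderDl opprD.
by rewrite addrACA.
Qed.

Lemma lieNr V Z : lie V (- Z) = - lie V Z.
Proof.
by apply: vfieldP => i; rewrite [RHS]vfieldNE !lieE vfieldNE vderN vderNl opprB opprK
  addrC.
Qed.

Lemma lieBr V Z Z' : lie V (Z - Z') = lie V Z - lie V Z'.
Proof. by rewrite lieDr lieNr. Qed.

Lemma lie0r V : lie V 0 = 0.
Proof. by rewrite -[in LHS](subrr 0) lieBr subrr. Qed.

Lemma lieDl V V' Z : lie (V + V') Z = lie V Z + lie V' Z.
Proof. by rewrite lieC lieDr opprD -!lieC. Qed.

Lemma lieBl V V' Z : lie (V - V') Z = lie V Z - lie V' Z.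
Proof. by rewrite lieC lieBr opprB [lie V Z]lieC [lie V' Z]lieC opprK addrC. Qed.

Lemma lie0l Z : lie 0 Z = 0.
Proof. by rewrite lieC lie0r oppr0. Qed.

End Derivations.

(** * Supports and orders with respect to the weights *)

Section Supports.

Variables (K : fieldType) (n : nat) (p : 'I_n -> nat).
Implicit Types (f g : fps K n) (V Z : vfield K n) (m : 'X_{1..n}).
Implicit Types (P Q S : pred int) (N k : int).

(** Integer-valued because the degrees [wt m - p i] of vector fields may be negative. *)
Definition wt m : int := (\sum_(j < n) p j * m j)%N%:Z.

Lemma wtD : {morph wt : a b / (a + b)%MM >-> a + b}.
Proof.
move=> a b; rewrite /wt -PoszD -big_split; congr Posz.
by apply: eq_bigr => j _; rewrite mnmDE mulnDr.
Qed.

Lemma wtU j : wt U_(j)%MM = p j.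
Proof.
rewrite /wt (bigD1 j) //= mnm1E eqxx muln1 big1 ?addn0 // => i /negPf ne.
by rewrite mnm1E eq_sym ne muln0.
Qed.

Lemma wt0 : wt 0%MM = 0.
Proof. by rewrite /wt big1 // => j _; rewrite mnm0E muln0. Qed.

Lemma wt_ge0 m : 0 <= wt m.
Proof. by []. Qed.

(** Arbitrary predicates let one set of closure lemmas serve a single degree ([pred1 k]), all
    degrees but one ([predC1 k]) and lower bounds ([ford], [vord]). *)
Definition fsupp P f := forall m, f m != 0 -> P (wt m).
Definition vsupp P V := forall i, fsupp (fun d => P (d - (p i)%:Z)) (V i 0).
Definition ford N := fsupp (fun d => N <= d).
Definition vord N := vsupp (fun d => N <= d).

Lemma fsuppW P Q f : (forall d, P d -> Q d) -> fsupp P f -> fsupp Q f.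
Proof. by move=> PQ Pf m /Pf/PQ. Qed.

Lemma fsupp0 P : fsupp P (0 : fps K n).
Proof. by move=> m; rewrite coef_fps0 eqxx. Qed.

Lemma fsuppD P f g : fsupp P f -> fsupp P g -> fsupp P (f + g).
Proof.
move=> Pf Pg m; rewrite coef_fpsD.
by have [->|/Pf//] := eqVneq (f m) 0; rewrite add0r => /Pg.
Qed.

Lemma fsuppN P f : fsupp P f -> fsupp P (- f).
Proof. by move=> Pf m; rewrite coef_fpsN oppr_eq0 => /Pf. Qed.

Lemma fsuppB P f g : fsupp P f -> fsupp P g -> fsupp P (f - g).
Proof. by move=> Pf Pg; apply: fsuppD (fsuppN Pg). Qed.

Lemma fsupp_sum P I (r : seq I) (A : pred I) (F : I -> fps K n) :
  (forall i, A i -> fsupp P (F i)) -> fsupp P (\sum_(i <- r | A i) F i).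
Proof.
by move=> PF; elim/big_rec: _ => [|i f Ai Pf];
  [exact: fsupp0|apply: fsuppD => //; exact: PF].
Qed.

Lemma fsuppM P Q S f g : fsupp P f -> fsupp Q g ->
  (forall a b, P a -> Q b -> S (a + b)) -> fsupp S (f * g).
Proof.
move=> Pf Qg PQS m; apply: contraNT => nS; rewrite coef_fpsM /=.
apply/eqP; apply: big1 => -[[a lta] [b ltb]] /= /eqP em; apply/eqP.
apply: contraNT nS; rewrite mulf_eq0 => /norP[/Pf Pa /Qg Qb].
by rewrite em wtD; apply: PQS.
Qed.

Lemma fsuppCM P c f : fsupp P f -> fsupp P (fpsC c * f).
Proof.
move=> Pf m; rewrite coef_fpsCM => nz; apply: Pf.
by apply: contraNneq nz => ->; rewrite mulr0.
Qed.

Lemma fsupp_deriv P j f :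
  fsupp P f -> fsupp (fun d => P (d + (p j)%:Z)) (fps_deriv j f).
Proof.
move=> Pf m nz; rewrite -wtU -wtD; apply: Pf.
by apply: contraNneq nz => e; rewrite /= e mul0rn.
Qed.

(** Differentiation by x_j lowers the weight by [p j], which the shift in [vsupp] compensates; hence
    degrees add. *)
Lemma fsupp_vder P Q S V f : vsupp P V -> fsupp Q f ->
  (forall a b, P a -> Q b -> S (a + b)) -> fsupp S (vder V f).
Proof.
move=> PV Qf PQS; apply: fsupp_sum => j _.
apply: fsuppM (PV j) (fsupp_deriv (j := j) Qf) _ => a b Pa Qb.
by have := PQS _ _ Pa Qb; rewrite addrA addrAC addrNK addrC addrC.
Qed.

Lemma vsuppW P Q V : (forall d, P d -> Q d) -> vsupp P V -> vsupp Q V.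
Proof. by move=> PQ PV i; apply: fsuppW (PV i) => d; apply: PQ. Qed.

Lemma vsupp0 P : vsupp P (0 : vfield K n).
Proof. by move=> i; rewrite mxE; apply: fsupp0. Qed.

Lemma vsuppD P V Z : vsupp P V -> vsupp P Z -> vsupp P (V + Z).
Proof. by move=> PV PZ i; rewrite vfieldDE; apply: fsuppD. Qed.

Lemma vsuppN P V : vsupp P V -> vsupp P (- V).
Proof. by move=> PV i; rewrite vfieldNE; apply: fsuppN. Qed.

Lemma vsuppB P V Z : vsupp P V -> vsupp P Z -> vsupp P (V - Z).
Proof. by move=> PV PZ; apply: vsuppD (vsuppN PZ). Qed.

Lemma vsupp_sum P I (r : seq I) (A : pred I) (F : I -> vfield K n) :
  (forall i, A i -> vsupp P (F i)) -> vsupp P (\sum_(i <- r | A i) F i).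
Proof.
by move=> PF; elim/big_rec: _ => [|i f Ai Pf];
  [exact: vsupp0|apply: vsuppD => //; exact: PF].
Qed.

Lemma vsuppZ P Q S f V : fsupp P f -> vsupp Q V ->
  (forall a b, P a -> Q b -> S (a + b)) -> vsupp S (f *: V).
Proof.
move=> Pf QV PQS i; rewrite vfieldZE; apply: fsuppM Pf (QV i) _ => a b Pa Qb.
by have := PQS _ _ Pa Qb; rewrite addrA.
Qed.

Lemma vsuppCZ P c V : vsupp P V -> vsupp P (fpsC c *: V).
Proof. by move=> PV i; rewrite vfieldZE; apply: fsuppCM. Qed.

Lemma vsupp_lie P Q S V Z : vsupp P V -> vsupp Q Z ->
  (forall a b, P a -> Q b -> S (a + b)) -> vsupp S (lie V Z).
Proof.
move=> PV QZ PQS i; rewrite lieE; apply: fsuppB.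
  by apply: fsupp_vder PV (QZ i) _ => a b Pa Qb; have := PQS _ _ Pa Qb; rewrite addrA.
apply: fsupp_vder QZ (PV i) _ => a b Qa Pb.
by have := PQS _ _ Pb Qa; rewrite addrAC [b + a]addrC.
Qed.

Lemma fordW N k f : k <= N -> ford N f -> ford k f.
Proof. by move=> le; apply: fsuppW => d; apply: le_trans. Qed.

Lemma vordW N k V : k <= N -> vord N V -> vord k V.
Proof. by move=> le; apply: vsuppW => d; apply: le_trans. Qed.

Lemma ford_ge0 f : ford 0 f.
Proof. by []. Qed.

Lemma fordM a b f g : ford a f -> ford b g -> ford (a + b) (f * g).
Proof. by move=> fa gb; apply: fsuppM fa gb _ => x y; apply: lerD. Qed.

Lemma ford_vder a b V f : vord a V -> ford b f -> ford (a + b) (vder V f).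
Proof. by move=> Va fb; apply: fsupp_vder Va fb _ => x y; apply: lerD. Qed.

Lemma vordZ a b f V : ford a f -> vord b V -> vord (a + b) (f *: V).
Proof. by move=> fa Vb; apply: vsuppZ fa Vb _ => x y; apply: lerD. Qed.

Lemma vord_lie a b V Z : vord a V -> vord b Z -> vord (a + b) (lie V Z).
Proof. by move=> Va Zb; apply: vsupp_lie Va Zb _ => x y; apply: lerD. Qed.

Lemma ford_eq0 f : (forall N, ford N f) -> f = 0.
Proof.
move=> f0; apply: fpsP => m; rewrite coef_fps0; apply/eqP.
by apply/negPn/negP => /(f0 (wt m + 1)); rewrite gerDl.
Qed.

Lemma vord_eq0 V : (forall N, vord N V) -> V = 0.
Proof.
move=> V0; apply: vfieldP => i; rewrite mxE; apply: ford_eq0 => N m nz.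
by have := V0 (N - (p i)%:Z) i m nz; rewrite lerD2r.
Qed.

(** A common upper bound for the [p i]: every vector field has order at least [- lowdeg], which
    gives expansions a first degree. *)
Definition lowdeg : int := (\sum_i p i)%N%:Z.

Lemma vord_low V : vord (- lowdeg) V.
Proof.
move=> i m _; rewrite lerBrDr; apply: le_trans (wt_ge0 m).
by rewrite addrC subr_le0 lez_nat (bigD1 i) //= leq_addr.
Qed.

Definition fpart k f : fps K n := Fps (fun m => if wt m == k then f m else 0).

Lemma fsupp_fpart k f : fsupp (pred1 k) (fpart k f).
Proof. by move=> m /=; case: ifP => // _; rewrite eqxx. Qed.

Lemma fsupp_fpartC k f : fsupp (predC1 k) (f - fpart k f).
Proof.
by move=> m; rewrite coef_fpsD coef_fpsN /=; case: ifP => //; rewrite subrr eqxx.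
Qed.

Lemma qpartE k V i m :
  qpart p k V i 0 m = if wt m - (p i)%:Z == k then V i 0 m else 0.
Proof. by rewrite mxE. Qed.

Lemma qpartD k V Z : qpart p k (V + Z) = qpart p k V + qpart p k Z.
Proof.
apply: vfieldP => i; apply: fpsP => m; rewrite vfieldDE coef_fpsD !qpartE.
by rewrite vfieldDE coef_fpsD; case: ifP; rewrite ?addr0.
Qed.

Lemma vsupp_qpart k V : vsupp (pred1 k) (qpart p k V).
Proof. by move=> i m; rewrite qpartE /=; case: ifP => //; rewrite eqxx. Qed.

Lemma vsupp_qpartC k V : vsupp (predC1 k) (V - qpart p k V).
Proof.
move=> i m; rewrite vfieldDE vfieldNE coef_fpsD coef_fpsN qpartE /=.
by case: ifP => //; rewrite subrr eqxx.
Qed.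

Lemma qpart_id k V : vsupp (pred1 k) V -> qpart p k V = V.
Proof.
move=> Vk; apply: vfieldP => i; apply: fpsP => m; rewrite qpartE.
by case: ifP => // /negbT ne; apply/esym/eqP; apply: contraNT ne => /(Vk i).
Qed.

Lemma qpart_eq0 k V : vsupp (predC1 k) V -> qpart p k V = 0.
Proof.
move=> Vk; apply: vfieldP => i; apply: fpsP => m; rewrite qpartE mxE coef_fps0.
by case: ifP => // e; apply/eqP; apply: contraTT e => /(Vk i).
Qed.

Lemma qpart_ord k N V : k < N -> vord N V -> qpart p k V = 0.
Proof.
move=> lt VN; apply: qpart_eq0; apply: vsuppW VN => d /= le.
by rewrite gt_eqF // (lt_le_trans lt).
Qed.

(** Bracketing with [V] shifts all degrees by [d], so parts of [Z] of degree other than [k] cannot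
    reach degree [d + k]. *)
Lemma qpart_lie d k V Z : vsupp (pred1 d) V ->
  qpart p (d + k) (lie V Z) = lie V (qpart p k Z).
Proof.
move=> Vd; rewrite -{1}[Z](subrK (qpart p k Z)) lieDr qpartD qpart_eq0.
  rewrite add0r qpart_id //; apply: vsupp_lie Vd (@vsupp_qpart k Z) _.
  by move=> a b /= /eqP-> /eqP->.
apply: vsupp_lie Vd (@vsupp_qpartC k Z) _ => a b /= /eqP->.
by rewrite (inj_eq (addrI _)).
Qed.

Lemma qpartZ d k f V : vsupp (pred1 d) V ->
  qpart p (d + k) (f *: V) = fpart k f *: V.
Proof.
move=> Vd; rewrite -{1}[f](subrK (fpart k f)) scalerDl qpartD qpart_eq0.
  rewrite add0r qpart_id //; apply: vsuppZ (@fsupp_fpart k f) Vd _.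
  by move=> a b /= /eqP-> /eqP->; rewrite addrC.
apply: vsuppZ (@fsupp_fpartC k f) Vd _ => a b /= ne /eqP->.
by rewrite addrC (inj_eq (addrI _)).
Qed.

Lemma vord_qpart_step N V : vord N V -> vord (N + 1) (V - qpart p N V).
Proof.
move=> VN i m nz.
have /= ne := vsupp_qpartC nz.
suff : N <= wt m - (p i)%:Z by move: ne; lia.
apply: VN; apply: contraNneq nz.
by rewrite vfieldDE vfieldNE coef_fpsD coef_fpsN qpartE => ->; rewrite if_same subrr.
Qed.

(** Euler's identity, one variable at a time: x_j d/dx_j multiplies the coefficient of x^m by
    m_j. *)
Lemma vder_euler f m : vder (euler K p) f m = (wt m)%:~R * f m.
Proof.
rewrite coef_fps_sum /wt -pmulrn natr_sum mulr_suml; apply: eq_bigr => j _.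
rewrite mxE; set e := Fps _.
have -> : e = fpsC (p j)%:R * Fps (fun m => ('X_j : {mpoly K[n]})@_m).
  apply: fpsP => a; rewrite coef_fpsCM /= mcoeffX eq_sym.
  by case: eqP; rewrite ?mulr1 ?mulr0.
rewrite -mulrA coef_fpsCM natrM -mulrA; congr (_ * _).
pose q := fps_trunc (mdeg m).+2 f.
rewrite coef_fpsM (fps_mul_mpoly (p := 'X_j) (q := q^`M(j))) //; last first.
  by move=> k lek; rewrite mcoeff_deriv mcoeff_trunc // mdegD mdeg1 addn1 !ltnS.
rewrite mulrC [RHS]mulrC; have [mj0|mj_gt0] := posnP (m j).
  rewrite mj0 mulr0 mcoeffM big1 // => -[[a lta] [b ltb]] /= /eqP em.
  rewrite mcoeffX; case: eqP => [e1|_]; last by rewrite mulr0.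
  by move: mj0; rewrite em mnmDE -e1 mnm1E eqxx addn1.
have mE : (U_(j) + (m - U_(j)))%MM = m.
  by apply/mnmP => i; rewrite mnmDE mnmBE mnm1E; case: eqP => [<-|_]; lia.
rewrite -[in LHS]mE mcoeffMX mcoeff_deriv addmC mE mcoeff_trunc //.
by rewrite mnmBE mnm1E eqxx subn1 prednK // mulr_natr.
Qed.

End Supports.

(** * Quasi-homogeneity in characteristic zero and closedness of graded sets *)

Section Graded.

Variables (K : fieldType) (n : nat) (p : 'I_n -> nat).
Hypothesis char0 : forall k, k.+1%:R != 0 :> K.
Implicit Types (f g : fps K n) (V Z : vfield K n) (m : 'X_{1..n}).
Implicit Types (M S : set (vfield K n)) (N k : int).

Definition fpsX (i : 'I_n) : fps K n := Fps (fun m => (m == U_(i)%MM)%:R).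

Lemma fps_derivX i j : fps_deriv j (fpsX i) = (i == j)%:R.
Proof.
apply: fpsP => m /=.
have -> : (m + U_(j) == U_(i))%MM = (m == 0%MM) && (i == j).
  apply/eqP/andP => [e|[/eqP-> /eqP->]]; last by rewrite add0m.
  have /eqP m0 : m == 0%MM.
    by rewrite -mdeg_eq0; move/(congr1 mdeg): e; rewrite mdegD !mdeg1; lia.
  split; first exact/eqP.
  by move/mnmP/(_ j): e; rewrite m0 add0m !mnm1E eqxx; case: eqP.
case: (eqVneq i j) => _; rewrite ?andbT ?andbF ?mul0rn ?coef_fps0 //.
by rewrite coef_fps1; case: eqP => [->|_]; rewrite ?mnm0E ?mul0rn.
Qed.

Lemma vderX V i : vder V (fpsX i) = V i 0.
Proof.
rewrite /vder (bigD1 i) //= fps_derivX eqxx mulr1 big1 ?addr0 // => j ne.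
by rewrite fps_derivX eq_sym (negPf ne) mulr0.
Qed.

Lemma coef_fpsMz f k m : (f *~ k) m = f m *~ k.
Proof.
elim/int_rect: k => [|k IH|k IH]; first by rewrite !mulr0z coef_fps0.
  by rewrite intS !mulrzDr coef_fpsD IH !mulr1z.
by rewrite intS opprD !mulrzDr coef_fpsD IH !mulrNz !mulr1z.
Qed.

Lemma lie_euler Z i m :
  lie (euler K p) Z i 0 m = (wt p m - (p i)%:Z)%:~R * Z i 0 m.
Proof.
rewrite lieE coef_fpsD coef_fpsN vder_euler.
have -> : euler K p i 0 = fpsC (p i)%:R * fpsX i.
  apply: fpsP => a; rewrite coef_fpsCM mxE /=.
  by case: eqP; rewrite ?mulr1 ?mulr0.
by rewrite vderCM vderX coef_fpsCM rmorphB /= mulrBl pmulrn.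
Qed.

Lemma intr_char0 k : (k%:~R == 0 :> K) = (k == 0).
Proof.
have nat0 a : (a%:R == 0 :> K) = (a == 0%N).
  by case: a => [|a]; rewrite ?eqxx // (negPf (char0 a)).
by case: k => a; rewrite ?NegzE ?rmorphN ?oppr_eq0 -?pmulrn ?nat0.
Qed.

(** The Euler field acts diagonally, with eigenvalue [wt m - p i] on x^m d/dx_i; in characteristic
    zero an integer is determined by its image in [K]. *)
Lemma qhomP k Z : qhom p k Z <-> vsupp p (pred1 k) Z.
Proof.
have e i m : (Z *~ k) i 0 m = k%:~R * Z i 0 m.
  by rewrite -scaler_int vfieldZE !mulrzl coef_fpsMz.
split=> [kZ i m nz|kZ].
  have := congr1 (fun V : vfield K n => V i 0 m) kZ; rewrite /= e lie_euler.
  by move/(mulIf nz)/eqP; rewrite -subr_eq0 -rmorphB intr_char0 subr_eq0.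
apply: vfieldP => i; apply: fpsP => m; rewrite e lie_euler.
by have [->|/(kZ i)/eqP->] := eqVneq (Z i 0 m) 0; rewrite ?mulr0.
Qed.

(** The degree [k] part of [V] is that of any approximant in [S] that agrees with [V] up to order
    [k + 1]. *)
Lemma graded_closed S V : graded p S ->
  (forall N, exists2 V', S V' & vord p N (V - V')) -> S V.
Proof.
move=> grS app; apply/grS => k.
have [V' SV' ord] := app (k + 1).
rewrite -[V](subrK V') qpartD (qpart_ord _ ord) ?add0r; last by rewrite ltrDl.
exact: (grS V').1.
Qed.

Lemma graded_lim S (s : nat -> vfield K n) V (e : int) : graded p S ->
  (forall a : nat, S (s a)) -> (forall a : nat, vord p (e + a%:Z) (V - s a)) -> S V.
Proof.
move=> grS Ss lim; apply: (graded_closed grS) => N.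
exists (s `|N - e|%N) => //; apply: vordW (lim _); lia.
Qed.

Definition linear_set S :=
  [/\ S 0, forall V Z, S V -> S Z -> S (V + Z) &
      forall c V, S V -> S (fpsC c *: V)].

Lemma subspace_linear S : subspace S -> linear_set S.
Proof.
move=> [S0 SP]; split=> // [V Z SV SZ|c V SV].
  suff <- : fpsC 1 *: V + Z = V + Z by apply: SP.
  by congr (_ + _); apply: scale1r.
by rewrite -[_ *: _]addr0; apply: SP.
Qed.

Lemma submodule_subspace S : submodule S -> subspace S.
Proof. by move=> [S0 SP]; split=> // c V Z; apply: SP. Qed.

Lemma linear_set_sum S I (r : seq I) (F : I -> vfield K n) : linear_set S ->
  (forall i, S (F i)) -> S (\sum_(i <- r) F i).
Proof.
move=> [S0 SD _] SF; elim: r => [|i r IH]; first by rewrite big_nil.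
by rewrite big_cons; apply: SD.
Qed.

Lemma linear_set_opp S V : linear_set S -> S V -> S (- V).
Proof.
move=> [_ _ SZ] /(SZ (-1)); suff -> : fpsC (-1) *: V = - V by [].
by rewrite -scaleN1r; congr (_ *: _); apply: fpsP => m /=; case: eqP; rewrite ?oppr0.
Qed.

Lemma vord_qpart_sum (e : int) (N : nat) V : vord p e V ->
  vord p (e + N%:Z) (V - \sum_(a < N) qpart p (e + a%:Z) V).
Proof.
move=> Ve; elim: N => [|N IH]; first by rewrite big_ord0 !subr0.
have := vord_qpart_step IH; rewrite big_ord_recr /= intS [1 + _]addrC addrA.
(* The parts already removed have degrees below [e + N]. *)
suff -> : qpart p (e + N) (V - \sum_(a < N) qpart p (e + a) V) = qpart p (e + N) V.
  by rewrite opprD addrA.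
rewrite qpartD [qpart _ _ (- _)]qpart_eq0 ?addr0 //.
apply: vsuppN; apply: vsupp_sum => a _; apply: vsuppW (vsupp_qpart (k := e + a) (V := V)).
by move=> d /= /eqP->; rewrite (inj_eq (addrI _)) eqz_nat ltn_eqF.
Qed.

(** [ad_stable] concerns quasi-homogeneous fields only; a general [V] is the limit of the partial
    sums of its parts, and the brackets with these converge as well. *)
Lemma ad_stable_lie M V Z : submodule M -> graded p M -> ad_stable p M ->
  M V -> M Z -> M (lie V Z).
Proof.
move=> sM grM adM MV MZ; have lM := subspace_linear (submodule_subspace sM).
pose e := - lowdeg p.
pose s a := lie (\sum_(i < a) qpart p (e + i%:Z) V) Z.
apply: (@graded_lim _ s _ (e + e)) => // a; last first.
  rewrite [e + e + _]addrAC /s -lieBl; apply: vord_lie; last exact: vord_low.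
  exact/vord_qpart_sum/vord_low.
rewrite /s (big_morph (fun U => lie U Z) (fun U U' => lieDl U U' Z) (lie0l Z)).
apply: linear_set_sum => // i; apply: (adM (e + i%:Z)) => //; first exact: (grM V).1.
exact/qhomP/vsupp_qpart.
Qed.

End Graded.

(** * The iterated Leibniz rule and the exponential of a vector field *)

Lemma iter_leibniz (U V W : zmodType) (d1 : U -> U) (d2 : V -> V) (d : W -> W)
    (B : U -> V -> W) u v c :
  {morph d : x y / x + y} ->
  (forall u v, d (B u v) = B (d1 u) v + B u (d2 v)) ->
  iter c d (B u v) =
    \sum_(a < c.+1) B (iter a d1 u) (iter (c - a) d2 v) *+ 'C(c, a).
Proof.
move=> dD dB; have d0 : d 0 = 0 by apply: (addrI (d 0)); rewrite -dD !addr0.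
have dMn x k : d (x *+ k) = d x *+ k.
  by elim: k => [|k IH]; rewrite ?mulr0n // !mulrS dD IH.
elim: c => [|c IH]; first by rewrite big_ord1.
rewrite iterS IH (big_morph d dD d0).
under eq_bigr do rewrite dMn dB mulrnDl.
rewrite big_split /= [RHS]big_ord_recl bin0 /=.
under [in RHS]eq_bigr do rewrite /bump /= add1n binS subSS mulrnDr.
rewrite big_split /= addrCA addrC [in RHS]addrA; congr (_ + _).
rewrite big_ord_recl subn0 bin0 [in RHS]big_ord_recr /= bin_small // mulr0n addr0.
rewrite addrC; congr (_ + _); apply: eq_bigr => a _.
by rewrite /bump /= add1n -(subnSK (ltn_ord a)).
Qed.

Section Exponential.

Variables (K : fieldType) (n : nat) (p : 'I_n -> nat).
Hypothesis char0 : forall k, k.+1%:R != 0 :> K.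
Implicit Types (f g : fps K n) (V X Z : vfield K n) (m : 'X_{1..n}).
Local Notation low := (lowdeg p).

Lemma cauchy_triangle (T : zmodType) (F : nat -> nat -> T) N :
  \sum_(c < N) \sum_(a < c.+1) F a (c - a)%N =
  \sum_(a < N) \sum_(b < N - a) F a b.
Proof.
elim: N => [|N IH]; first by rewrite !big_ord0.
rewrite big_ord_recr IH [RHS]big_ord_recr /= subSn // subnn big_ord1.
rewrite [X in _ + X]big_ord_recr /= subnn addrA; congr (_ + _).
rewrite -big_split; apply: eq_bigr => a _ /=.
by rewrite subSn 1?ltnW // big_ord_recr.
Qed.

(** A pair (a, b) of the square outside the triangle satisfies a + b >= N. *)
Lemma ford_cauchy (F : nat -> nat -> fps K n) (e : int) (N : nat) :
  (forall a b : nat, ford p (a%:Z + b%:Z - e) (F a b)) ->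
  ford p (N%:Z - e) (\sum_(a < N) \sum_(b < N) F a b
                     - \sum_(c < N) \sum_(a < c.+1) F a (c - a)%N).
Proof.
move=> Fe; rewrite cauchy_triangle -sumrB; apply: fsupp_sum => a _.
rewrite -(big_mkord xpredT (F a)) (big_cat_nat (n := (N - a)%N)) ?leq_subr //=.
rewrite big_mkord addrAC subrr add0r big_seq; apply: fsupp_sum => b.
rewrite mem_index_iota => /andP[leb _]; apply: fordW (Fe a b); lia.
Qed.

Definition invfact (a : nat) : fps K n := fpsC (a`!%:R^-1).

Lemma fpsC_natM k f : fpsC k%:R * f = f *+ k.
Proof.
apply: fpsP => m; rewrite coef_fpsCM mulr_natl.
by elim: k => [|k IH]; rewrite ?mulr0n ?coef_fps0 // !mulrS IH.
Qed.

Lemma invfactM c a f : (a <= c)%N ->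
  invfact c * (f *+ 'C(c, a)) = invfact a * invfact (c - a) * f.
Proof.
move=> lec; rewrite -fpsC_natM mulrA -!fpsCM; congr (fpsC _ * _).
have nz k : (0 < k)%N -> k%:R != 0 :> K by case: k => // j _; apply: char0.
rewrite -(bin_fact lec) !natrM; field.
by rewrite !nz ?fact_gt0 ?bin_gt0.
Qed.

Variable Z : vfield K n.

Definition fdpow a f : fps K n := invfact a * iter a (vder Z) f.
Definition vdpow a V : vfield K n := invfact a *: iter a (lie Z) V.

(** General in [B] so as to cover both the product of series and the action [vder] of fields on
    series; the inverse factorials absorb the binomial coefficients. *)
Lemma fdpow_leibniz (U : lmodType (fps K n)) (d1 : U -> U) (d2 : fps K n -> fps K n)
    (B : U -> fps K n -> fps K n) u v c :
    (forall c u v, B (fpsC c *: u) v = fpsC c * B u v) ->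
    (forall c u v, B u (fpsC c * v) = fpsC c * B u v) ->
    (forall u v, vder Z (B u v) = B (d1 u) v + B u (d2 v)) ->
  fdpow c (B u v) =
    \sum_(a < c.+1) B (invfact a *: iter a d1 u) (invfact (c - a) * iter (c - a) d2 v).
Proof.
move=> Bl Br dB.
rewrite /fdpow (iter_leibniz (d1 := d1) (d2 := d2)) //; last exact: vderD.
rewrite mulr_sumr; apply: eq_bigr => a _.
by rewrite invfactM -1?ltnS // Bl Br mulrA.
Qed.

(* Meaningful when s a has weighted order at least a - e, so that the terms left
   out of the coefficient of x^m vanish there. *)
Definition fsum (e : int) (s : nat -> fps K n) : fps K n :=
  Fps (fun m => \sum_(a < (absz (wt p m + e)%R).+1) s a m).

Lemma fsumP (e : int) (s : nat -> fps K n) (N : nat) : 0 <= e ->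
  (forall a : nat, ford p (a%:Z - e) (s a)) ->
  ford p (N%:Z - e) (fsum e s - \sum_(a < N) s a).
Proof.
move=> e0 se m; apply: contraNT; rewrite -ltNge => lt.
have leT : ((absz (wt p m + e)%R).+1 <= N)%N by have := wt_ge0 p m; lia.
rewrite coef_fpsD coef_fpsN coef_fps_sum /= subr_eq0; apply/eqP.
rewrite -!(big_mkord xpredT (fun a => s a m)).
rewrite [RHS](big_cat_nat (n := (absz (wt p m + e)%R).+1)) //=.
rewrite [X in _ = _ + X]big1_seq ?addr0 // => a; rewrite mem_index_iota.
move=> /andP[_ /andP[lea _]]; apply/eqP; apply: contraLR lea => /(se a).
by have := wt_ge0 p m; lia.
Qed.

(** The offset is 0 for series and [low] for fields: when [Z] has positive order, the components of
    [vdpow a V] have weight at least [a - low]. *)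
Definition fexp f : fps K n := fsum 0 (fun a => fdpow a f).
Definition vexp V : vfield K n := \col_i fsum low (fun a => vdpow a V i 0).

Lemma fdpowD a : {morph fdpow a : f g / f + g}.
Proof.
move=> f g; rewrite /fdpow -mulrDr; congr (_ * _).
by elim: a => //= k ->; rewrite vderD.
Qed.

Lemma fdpowCM a c f : fdpow a (fpsC c * f) = fpsC c * fdpow a f.
Proof.
rewrite /fdpow mulrCA; congr (_ * _).
by elim: a => //= k ->; rewrite vderCM.
Qed.

Lemma fdpow0 f : fdpow 0 f = f.
Proof. by rewrite /fdpow /invfact fact0 invr1 mul1r. Qed.

Lemma vdpow0 V : vdpow 0 V = V.
Proof. by rewrite /vdpow /invfact fact0 invr1; apply: scale1r. Qed.

Lemma vdpow1 V : vdpow 1 V = lie Z V.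
Proof. by rewrite /vdpow /invfact factS fact0 muln1 invr1; apply: scale1r. Qed.

Lemma fexpE f m : fexp f m = \sum_(a < (absz (wt p m + 0)%R).+1) fdpow a f m.
Proof. by []. Qed.

Lemma fexpD : {morph fexp : f g / f + g}.
Proof.
move=> f g; apply: fpsP => m; rewrite coef_fpsD !fexpE -big_split.
by apply: eq_bigr => a _; rewrite fdpowD.
Qed.

Lemma fexpCM c f : fexp (fpsC c * f) = fpsC c * fexp f.
Proof.
apply: fpsP => m; rewrite coef_fpsCM !fexpE mulr_sumr; apply: eq_bigr => a _.
by rewrite fdpowCM coef_fpsCM.
Qed.

Lemma fexp1 : fexp 1 = 1.
Proof.
apply: fpsP => m; rewrite fexpE big_ord_recl big1 ?addr0 ?fdpow0 // => a _.
rewrite /fdpow lift0.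
suff -> : iter a.+1 (vder Z) 1 = 0 by rewrite mulr0 coef_fps0.
by elim: (a : nat) => [|k /= ->]; [exact: vderC|exact: vder0].
Qed.

(** The weights [q] may differ from the [p] of the cutoff, because the ordinary degree, with all
    weights one, is needed as well. *)
Lemma fsupp_fexp (q : 'I_n -> nat) N f :
  vord q 0 Z -> ford q N f -> ford q N (fexp f).
Proof.
move=> Z0 fN m; apply: contraNT => nN /=; apply/eqP; apply: big1 => a _.
apply/eqP; apply: contraNT nN; apply: (fsuppCM (p := q) (P := fun d => N <= d)).
by elim: (a : nat) => //= k IH; have := ford_vder Z0 IH; rewrite add0r.
Qed.

Hypothesis Z1 : vord p 1 Z.

Lemma ford_fdpow (a : nat) N f : ford p N f -> ford p (N + a%:Z) (fdpow a f).
Proof.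
move=> fN; apply: fsuppCM; elim: a => [|a IH] /=; first by rewrite addr0.
by have := ford_vder Z1 IH; rewrite addrCA -intS.
Qed.

Lemma vord_vdpow (a : nat) N V : vord p N V -> vord p (N + a%:Z) (vdpow a V).
Proof.
move=> VN; apply: vsuppCZ; elim: a => [|a IH] /=; first by rewrite addr0.
by have := vord_lie Z1 IH; rewrite addrCA -intS.
Qed.

Lemma fexpP f (N : nat) : ford p N (fexp f - \sum_(a < N) fdpow a f).
Proof.
rewrite -[N%:Z]subr0; apply: fsumP => // a.
by rewrite subr0 -[a%:Z]add0r; apply: ford_fdpow.
Qed.

Lemma low_ge0 : 0 <= low.
Proof. by []. Qed.

(** One [low] comes from the order of [V], the other from passing from weights of components to
    degrees of fields, as [p i <= low]. *)
Lemma vexpP V (N : nat) :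
  vord p (N%:Z - low - low) (vexp V - \sum_(a < N) vdpow a V).
Proof.
move=> i m; rewrite vfieldDE vfieldNE mxE summxE => nz.
have lei : (p i)%:Z <= low by rewrite lez_nat (bigD1 i) //= leq_addr.
have Vlow (a : nat) : ford p (a%:Z - low) (vdpow a V i 0).
  move=> k nzk; have /= := vord_vdpow (a := a) (@vord_low _ _ p V) nzk.
  by lia.
have /= := fsumP (s := fun a => vdpow a V i 0) (N := N) low_ge0 Vlow nz.
by lia.
Qed.

Lemma fexp_approx N f : ford p N f -> ford p (N + 1) (fexp f - f).
Proof.
(* Enough terms for the tail to have order at least [N + 1]; of the terms kept, all but the one for
   a = 0 raise the order. *)
move=> fN; pose k := absz (N + 1)%R.
rewrite -[fexp f](subrK (\sum_(a < k.+1) fdpow a f)) -addrA; apply: fsuppD.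
  apply: fordW (@fexpP f k.+1); rewrite /k; lia.
rewrite big_ord_recl fdpow0 addrAC subrr add0r.
by apply: fsupp_sum => a _; apply: fordW (ford_fdpow (a := a.+1) fN); lia.
Qed.

Lemma ford_fexp N f : ford p N f -> ford p N (fexp f).
Proof. by apply: fsupp_fexp; apply: vordW Z1. Qed.

(** Common core of the two exponential identities below. Modulo order [N - e], [u] and [fexp v] may
    be replaced by partial sums; the square of terms so obtained agrees with the triangle, which by
    the Leibniz rule is a partial sum of [fexp w]. *)
Lemma fexp_bilinear (U : zmodType) (B : U -> fps K n -> fps K n)
    (u : U) (s : nat -> U) v w (e : int) :
    (forall v, {morph B^~ v : x y / x + y}) ->
    (forall u, {morph B u : x y / x + y}) -> 0 <= e ->
    (forall N : nat, ford p (N%:Z - e) (B (u - \sum_(a < N) s a) (fexp v))) ->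
    (forall N : nat, ford p (N%:Z - e)
       (B (\sum_(a < N) s a) (fexp v - \sum_(b < N) fdpow b v))) ->
    (forall a b : nat, ford p (a%:Z + b%:Z - e) (B (s a) (fdpow b v))) ->
    (forall c, fdpow c w = \sum_(a < c.+1) B (s a) (fdpow (c - a) v)) ->
  fexp w = B u (fexp v).
Proof.
move=> Bl Br e0 ordl ordr ordab wE.
have Bl0 x : B 0 x = 0 by apply: (addrI (B 0 x)); rewrite -Bl !addr0.
have Br0 x : B x 0 = 0 by apply: (addrI (B x 0)); rewrite -Br !addr0.
apply/eqP; rewrite -subr_eq0; apply/eqP; apply: (@ford_eq0 _ _ p) => N0.
pose N := absz (N0 + e)%R; apply: (@fordW _ _ p (N%:Z - e)); first by rewrite /N; lia.
have := ordr N; have := ordl N; set su := \sum_(a < N) s a.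
set sv := \sum_(b < N) fdpow b v => oul ovr.
(* Four errors of order at least [N - e]: the tail of [fexp w], the square minus the triangle, and
   the tails in either argument of [B]. *)
have -> : fexp w - B u (fexp v) =
    (fexp w - \sum_(c < N) fdpow c w) - (B su sv - \sum_(c < N) fdpow c w)
    - B (u - su) (fexp v) - B su (fexp v - sv).
  have -> : B u (fexp v) = B (u - su) (fexp v) + B su (fexp v) by rewrite -Bl subrK.
  have -> : B su (fexp v) = B su (fexp v - sv) + B su sv by rewrite -Br subrK.
  ring.
apply: fsuppB => //; apply: fsuppB => //; apply: fsuppB.
  by apply: (@fordW _ _ p N%:Z); [lia|apply: fexpP].
have -> : B su sv = \sum_(a < N) \sum_(b < N) B (s a) (fdpow b v).
  rewrite /su (big_morph _ (Bl sv) (Bl0 sv)); apply: eq_bigr => a _.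
  exact: (big_morph _ (Br (s a)) (Br0 (s a))).
have -> : \sum_(c < N) fdpow c w = \sum_(c < N) \sum_(a < c.+1) B (s a) (fdpow (c - a) v).
  by apply: eq_bigr => c _; rewrite wE.
by apply: (@ford_cauchy (fun a b => B (s a) (fdpow b v)) e N).
Qed.

Lemma fexpM : {morph fexp : f g / f * g}.
Proof.
move=> f g; have o0 h : ford p 0 h by exact: ford_ge0.
have dord (a : nat) h : ford p a%:Z (fdpow a h).
  by rewrite -[a%:Z]add0r; apply: ford_fdpow.
apply: (@fexp_bilinear _ *%R _ (fun a => fdpow a f) g (f * g) 0) => //.
- by move=> h x y; rewrite mulrDl.
- by move=> h x y; rewrite mulrDr.
- by move=> N; rewrite -[N%:Z]addr0 subr0; apply: fordM => //; exact: fexpP.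
- by move=> N; rewrite -[N%:Z]add0r subr0; apply: fordM => //; exact: fexpP.
- by move=> a b; rewrite subr0; apply: fordM.
- move=> c; apply: (@fdpow_leibniz (fps K n)^o (vder Z) (vder Z) *%R).
  + by move=> *; rewrite /GRing.scale /= mulrA.
  + by move=> *; rewrite mulrCA.
  + by move=> *; rewrite vderM.
Qed.

(** The conjugation formula exp(Z) V exp(-Z) = exp(ad_Z) V, written without an inverse. The Leibniz
    rule behind it is [vder_lie]. *)
Lemma vder_vexp V f : vder (vexp V) (fexp f) = fexp (vder V f).
Proof.
have o0 h : ford p 0 h by exact: ford_ge0.
have dord (a : nat) h : ford p a%:Z (fdpow a h).
  by rewrite -[a%:Z]add0r; apply: ford_fdpow.
have vord_low2 (a : nat) : vord p (a%:Z - low) (vdpow a V).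
  by rewrite addrC; apply: vord_vdpow; apply: vord_low.
apply/esym.
apply: (@fexp_bilinear _ (@vder K n) _ (fun a => vdpow a V) f (vder V f)
  (low + low)) => //.
- by move=> h x y; rewrite vderDl.
- exact: vderD.
- move=> N; rewrite -[_ - _]addr0; apply: ford_vder => //.
  by rewrite opprD addrA; apply: vexpP.
- move=> N; apply: (@fordW _ _ p (- low + N%:Z)); first by have := low_ge0; lia.
  by apply: ford_vder; [apply: vord_low|apply: fexpP].
- move=> a b; apply: (@fordW _ _ p (a%:Z - low + b%:Z)); first by have := low_ge0; lia.
  exact: ford_vder.
- move=> c; apply: (@fdpow_leibniz _ (lie Z) (vder Z) (@vder K n)).
  + by move=> *; rewrite vderZl.
  + by move=> *; rewrite vderCM.
  + by move=> U h; rewrite vder_lie subrK.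
Qed.

End Exponential.

(** * The time-one flow as a formal diffeomorphism *)

Section FlowMap.

Variables (K : fieldType) (n : nat) (p : 'I_n -> nat).
Hypothesis char0 : forall k, k.+1%:R != 0 :> K.
Hypothesis p_gt0 : forall i, (0 < p i)%N.
Implicit Types (f g : fps K n) (V X Z : vfield K n) (m : 'X_{1..n}).
Implicit Types q : {mpoly K[n]}.

Definition fps_of_mpoly q : fps K n := Fps (fun m => q@_m).

Lemma fps_of_mpolyM : {morph fps_of_mpoly : q r / q * r}.
Proof.
by move=> q r; apply: fpsP => m; rewrite coef_fpsM; apply/esym/fps_mul_mpoly.
Qed.

Lemma fps_of_mpoly1 : fps_of_mpoly 1 = 1.
Proof. by apply: fpsP => m; rewrite coef_fps1 /= mcoeff1; case: eqP. Qed.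

Lemma fps_of_mpolyX m :
  fps_of_mpoly 'X_[m] = \prod_(i < n) fpsX K i ^+ m i.
Proof.
rewrite mpolyXE_id (big_morph _ fps_of_mpolyM fps_of_mpoly1).
apply: eq_bigr => i _.
have -> : fpsX K i = fps_of_mpoly 'X_i.
  by apply: fpsP => a; rewrite /= mcoeffX eq_sym.
elim: (m i) => [|k IH]; first by rewrite !expr0 fps_of_mpoly1.
by rewrite !exprS fps_of_mpolyM IH.
Qed.

Variable Z : vfield K n.
Hypothesis Z1 : vord p 1 Z.

Local Notation E := (fexp p Z).

Definition flow : vfield K n := \col_i E (fpsX K i).

Lemma wt_mdeg m : wt (fun=> 1%N) m = mdeg m.
Proof.
by rewrite /wt mdegE; congr Posz; apply: eq_bigr => j _; rewrite mul1n.
Qed.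

(* fps_comp truncates by ordinary degree, so fexp_comp needs the ordinary order
   filtration as well as the weighted one. *)
Lemma vord_standard : vord (fun=> 1%N) 0 Z.
Proof.
move=> i m nz; have /= := Z1 nz; rewrite subr_ge0 wt_mdeg lez_nat lt0n mdeg_eq0.
by apply: contraTneq => ->; rewrite wt0; lia.
Qed.

Lemma fexp_sum I (r : seq I) (F : I -> fps K n) :
  E (\sum_(i <- r) F i) = \sum_(i <- r) E (F i).
Proof.
apply: (big_morph E (@fexpD _ _ p Z)).
by apply: (addrI (E 0)); rewrite -fexpD !addr0.
Qed.

Lemma fexp_prod I (r : seq I) (F : I -> fps K n) :
  E (\prod_(i <- r) F i) = \prod_(i <- r) E (F i).
Proof. exact: (big_morph E (fexpM char0 Z1) (fexp1 p Z)). Qed.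

(** On polynomials this follows from linearity and multiplicativity of exp(Z). The part of [f] of
    ordinary degree at least [d] contributes nothing at x^m, and [fps_comp] cuts it off. *)
Lemma fexp_comp f : E f = fps_comp f flow.
Proof.
apply: fpsP => m; pose d := (mdeg m).+1.
pose t := fps_of_mpoly (fps_trunc d f).
have tE : t = \sum_(a : 'X_{1..n < d}) fpsC (f a) * fps_of_mpoly 'X_[a].
  apply: fpsP => k; rewrite coef_fps_sum [LHS]/= /fps_trunc raddf_sum.
  by apply: eq_bigr => a _; rewrite coef_fpsCM; apply: mcoeffZ.
have rest : ford (fun=> 1%N) d%:Z (f - t).
  move=> k; apply: contraNT; rewrite wt_mdeg -ltNge ltz_nat => lt.
  by rewrite coef_fpsD coef_fpsN /= mcoeff_trunc // subrr.
have Erest : E (f - t) m = 0.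
  apply/eqP/negPn/negP => /(fsupp_fexp vord_standard rest).
  by rewrite wt_mdeg lez_nat ltnn.
rewrite -[f in E f](subrK t) fexpD coef_fpsD Erest add0r tE fexp_sum coef_fps_sum.
apply: eq_bigr => a _; rewrite fexpCM coef_fpsCM fps_of_mpolyX fexp_prod.
congr (_ * fcoef _ m); apply: eq_bigr => i _; rewrite mxE.
elim: (a i) => [|k IH]; first by rewrite !expr0 fexp1.
by rewrite !exprS (fexpM char0 Z1) IH.
Qed.

Lemma fpsX_ord i : ford p (p i)%:Z (fpsX K i).
Proof.
by move=> m /=; have [->|_] := eqVneq m U_(i)%MM; [rewrite wtU|rewrite eqxx].
Qed.

(** exp(Z) x_i has weighted order at least [p i], which is positive. *)
Lemma flow0 i : flow i 0 0%MM = 0.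
Proof.
rewrite mxE; apply/eqP; apply: contraTT (p_gt0 i) => /(ford_fexp Z1 (@fpsX_ord i)).
by rewrite wt0 lez_nat -leqNgt.
Qed.

(** exp(Z) x_i - x_i has order at least [p i + 1], which excludes every x_j with [p j <= p i]. *)
Lemma flow_linear_part i j : (p j <= p i)%N ->
  jacobian flow i j 0%MM = (i == j)%:R.
Proof.
have dE f : fps_deriv j f 0%MM = f U_(j)%MM by rewrite /= mnm0E mulr1n add0m.
move=> le; rewrite !mxE dE.
have -> : E (fpsX K i) U_(j)%MM = (U_(j)%MM == U_(i)%MM)%:R.
  apply/eqP; rewrite -subr_eq0; apply/negPn/negP.
  by move/(fexp_approx Z1 (@fpsX_ord i)); rewrite wtU; lia.
have -> : (U_(j)%MM == U_(i)%MM) = (i == j) :> bool.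
  apply/eqP/eqP => [|->//] /mnmP/(_ j); rewrite !mnm1E eqxx.
  by case: (i == j) / eqP.
by [].
Qed.

(* A is unipotent for the ordering of the indices by weight: among the nonzero
   entries of a kernel vector, consider one of minimal weight. *)
Lemma unitmx_of_kernel (A : 'M[K]_n) :
  (forall i j, (p j <= p i)%N -> A i j = (i == j)%:R) -> A \in unitmx.
Proof.
move=> AE; rewrite -row_free_unit; apply: inj_row_free => v vA.
apply/eqP; apply: contraT => /rV0Pn[j0 nz0].
pose j := [arg min_(j < j0 | v 0 j != 0) p j].
have [nzj jmin] : v 0 j != 0 /\ forall i, v 0 i != 0 -> (p j <= p i)%N.
  by rewrite /j; case: arg_minnP.
have := congr1 (fun u : 'rV_n => u 0 j) vA; rewrite !mxE (bigD1 j) //=.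
rewrite AE // eqxx mulr1 big1 ?addr0 => [/eqP|i ne]; first by rewrite (negPf nzj).
have [->|nzi] := eqVneq (v 0 i) 0; first by rewrite mul0r.
by rewrite AE ?jmin // (negPf ne) mulr0.
Qed.

Lemma flow_diffeo : formal_diffeo flow.
Proof.
split; first exact: flow0.
by apply: unitmx_of_kernel => i j le; rewrite mxE flow_linear_part.
Qed.

(** Taking constant coefficients commutes with the determinant, and a series is invertible exactly
    when its constant coefficient is nonzero. *)
Lemma unitmx_const (A : 'M[fps K n]_n) :
  \matrix_(i, j) A i j 0%MM \in unitmx -> A \in unitmx.
Proof.
rewrite !unitmxE unitfE => nz; change (is_true ((\det A) 0%MM != 0)).
suff -> : (\det A) 0%MM = \det (\matrix_(i, j) A i j 0%MM) by [].
rewrite /determinant coef_fps_sum; apply: eq_bigr => s _.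
have cM : {morph (fun f : fps K n => f 0%MM) : f g / f * g}.
  by move=> f g; exact: coef_fpsM0.
have c1 : (1 : fps K n) 0%MM = 1 by rewrite coef_fps1 eqxx.
rewrite cM (big_morph _ cM c1); congr (_ * _).
  by case: (perm.odd_perm s); rewrite ?expr0 ?expr1 // coef_fpsN c1.
by apply: eq_bigr => i _; rewrite mxE.
Qed.

(** Entry [i] of the Jacobian times [vexp p Z X] is this field applied to exp(Z) x_i; by conjugation
    it equals exp(Z) X_i, which is X_i composed with the flow. *)
Lemma pullback_flow X : pullback flow X = vexp p Z X.
Proof.
rewrite /pullback; suff <- : jacobian flow *m vexp p Z X = \col_i fps_comp (X i 0) flow.
  by rewrite mulKmx //; apply: unitmx_const; case: flow_diffeo.
apply: vfieldP => i; rewrite !mxE -fexp_comp -vderX -(vder_vexp char0 Z1).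
by apply: eq_bigr => j _; rewrite !mxE mulrC.
Qed.

End FlowMap.

(** * Completeness for the weighted order *)

Section Limits.

Variables (K : fieldType) (n : nat) (p : 'I_n -> nat).

Lemma ford_limit (s : nat -> fps K n) (e : int) :
  (forall a : nat, ford p (e + a%:Z) (s a.+1 - s a)) ->
  exists f, forall a : nat, ford p (e + a%:Z) (f - s a).
Proof.
move=> cvg.
have stable m (a b : nat) : (a <= b)%N -> wt p m < e + a%:Z -> s b m = s a m.
  move=> le lt; rewrite -(subnK le); elim: (b - a)%N => // k IH.
  rewrite -IH addSn; apply/eqP; rewrite -subr_eq0; apply/negPn/negP => nz.
  by have /= := cvg (k + a)%N m nz; lia.
(* From index [N m] on, the coefficient of x^m no longer changes. *)
pose N m := (absz (wt p m - e)%R).+1.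
exists (Fps (fun m => s (N m) m)) => a m; apply: contraNT; rewrite -ltNge => lt.
rewrite coef_fpsD coef_fpsN /= subr_eq0.
have ltN : wt p m < e + (N m)%:Z by rewrite /N; lia.
by case/orP: (leq_total a (N m)) => le; [|apply/eqP/esym/eqP];
  rewrite (stable m _ _ le).
Qed.

Lemma vord_limit (s : nat -> vfield K n) (e : int) :
  (forall a : nat, vord p (e + a%:Z) (s a.+1 - s a)) ->
  exists V, forall a : nat, vord p (e + a%:Z) (V - s a).
Proof.
move=> cvg.
have lim i : exists f, forall a : nat, ford p (e + (p i)%:Z + a%:Z) (f - s a i 0).
  apply: (ford_limit (s := fun a => s a i 0)) => a m nz.
  have /= := cvg a i m; rewrite vfieldDE vfieldNE => /(_ nz); lia.
have [F FP] := choice lim.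
exists (\col_i F i) => a i m; rewrite vfieldDE vfieldNE mxE => /FP; lia.
Qed.

End Limits.

(** * Identities between columns, checked entrywise so that they become ring identities *)

Section Identities.

Variables (A : comNzRingType) (n : nat).
Implicit Types (V X Y l s : 'cV[A]_n) (u g : A).

Lemma perturb_identity X l l' s s' :
  X + (l' + s') - (X + (l + s)) - (l' - l) = s' - s.
Proof. by apply/matrixP => i j; rewrite !mxE; ring. Qed.

Lemma telescope_identity V V' s s' l :
  V' - V - l = (V' - s') - (V - s) + (s' - s - l).
Proof. by apply/matrixP => i j; rewrite !mxE; ring. Qed.

(** Here [V] and [V'] are exp(ad_Z) X before and after adding zeta to Z, while [l] and [l0] are
    [zeta, X] and [zeta, X_0]. *)
Lemma step_identity V V' X0 Y y l l0 u g :
  V' - (u + g) *: (X0 + (Y + y)) =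
    (V - u *: (X0 + Y) - (- l0 + g *: X0 + y)) + (V' - V - l) + (l - l0)
    - g *: Y - (u + g - 1) *: y.
Proof. by apply/matrixP => i j; rewrite !mxE; ring. Qed.

Lemma limit_identity V V' X0 Y Y' l u u' :
  V' - u' *: (X0 + Y') =
    (V' - V - l) + l + (V - u *: (X0 + Y)) - (u' - u) *: (X0 + Y') - u *: (Y' - Y).
Proof. by apply/matrixP => i j; rewrite !mxE; ring. Qed.

End Identities.

(** * Dependence of exp(ad_Z) X on Z *)

Section Perturbation.

Variables (K : fieldType) (n : nat) (p : 'I_n -> nat).
Implicit Types (X Z : vfield K n).

Lemma vexp_approx Z X (d : int) : vord p 1 Z -> vord p d X ->
  vord p (d + 1) (vexp p Z X - X).
Proof.
move=> Z1 Xd; pose k := absz (d + 1 + lowdeg p + lowdeg p)%R.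
rewrite -[vexp p Z X](subrK (\sum_(a < k.+1) vdpow Z a X)) -addrA; apply: vsuppD.
  apply: (@vordW _ _ p (k.+1%:Z - lowdeg p - lowdeg p)); last exact: vexpP.
  by rewrite /k; lia.
rewrite big_ord_recl vdpow0 addrAC subrr add0r.
by apply: vsupp_sum => a _; apply: vordW (vord_vdpow Z1 (a := a.+1) Xd); lia.
Qed.

(** For a >= 1 the difference of the a-th powers of ad_Z' and ad_Z on [X] telescopes into terms with
    one factor from Z' - Z and a - 1 factors of order at least 1, so its order is at least d + k +
    a. Beyond the linear term only a >= 2 occurs. *)
Lemma vexp_perturb Z Z' X (d k : int) : 0 <= k ->
  vord p 1 Z -> vord p 1 Z' -> vord p (k + 1) (Z' - Z) -> vord p d X ->
  vord p (d + k + 2) (vexp p Z' X - vexp p Z X - lie (Z' - Z) X).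
Proof.
move=> k0 Z1 Z'1 ZZ Xd.
have it (a : nat) : vord p (d + a%:Z) (iter a (lie Z) X).
  elim: a => [|a IH] /=; first by rewrite addr0.
  by have := vord_lie Z1 IH; rewrite addrCA -intS.
have dit (a : nat) :
    vord p (d + k + a.+1%:Z) (iter a.+1 (lie Z') X - iter a.+1 (lie Z) X).
  elim: a => [|a IH].
    by rewrite /= -lieBl; apply: vordW (vord_lie ZZ Xd); lia.
  have -> : iter a.+2 (lie Z') X - iter a.+2 (lie Z) X =
      lie Z' (iter a.+1 (lie Z') X - iter a.+1 (lie Z) X)
      + lie (Z' - Z) (iter a.+1 (lie Z) X).
    by rewrite lieBr lieBl addrA subrK.
  apply: vsuppD; first by apply: vordW (vord_lie Z'1 IH); lia.
  by apply: vordW (vord_lie ZZ (it a.+1)); lia.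
(* Large enough for the tails beyond [N.+2] terms to be negligible; the two extra terms are split
   off explicitly. *)
pose N := absz (d + k + 2 + lowdeg p + lowdeg p)%R.
pose S U := \sum_(a < N.+2) vdpow U a X.
have recl2 (F : nat -> vfield K n) :
    \sum_(a < N.+2) F a = F 0%N + (F 1%N + \sum_(a < N) F a.+2).
  by rewrite 2!big_ord_recl.
have S2 U : S U = X + (lie U X + \sum_(a < N) vdpow U a.+2 X).
  by rewrite -{1}(vdpow0 U X) -vdpow1; exact: (recl2 (fun a => vdpow U a X)).
have SE : S Z' - S Z - lie (Z' - Z) X =
    \sum_(a < N) (vdpow Z' a.+2 X - vdpow Z a.+2 X).
  rewrite !S2 sumrB lieBl; exact: perturb_identity.
have appr U : vord p 1 U -> vord p (d + k + 2) (vexp p U X - S U).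
  move=> U1; apply: (@vordW _ _ p (N.+2%:Z - lowdeg p - lowdeg p)); last exact: vexpP.
  by rewrite /N; lia.
rewrite (telescope_identity _ _ (S Z) (S Z')).
apply: vsuppD; first by apply: vsuppB; apply: appr.
rewrite SE; apply: vsupp_sum => a _; rewrite /vdpow -scalerBr.
apply: vsuppCZ; apply: vordW (dit a.+1); lia.
Qed.

Lemma vexp_stable (M : set (vfield K n)) Z X :
  (forall k, k.+1%:R != 0 :> K) ->
  submodule M -> graded p M -> ad_stable p M ->
  vord p 1 Z -> M Z -> M X -> M (vexp p Z X).
Proof.
move=> char0 sM grM adM Z1 MZ MX; have lM := subspace_linear (submodule_subspace sM).
apply: (graded_lim (s := fun N => \sum_(a < N) vdpow Z a X)
  (e := - lowdeg p - lowdeg p) grM) => N.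
  apply: linear_set_sum => // a; case: lM => _ _; apply.
  by elim: (a : nat) => //= b IH; apply: (ad_stable_lie char0).
by rewrite addrC addrA; apply: vexpP.
Qed.

End Perturbation.

(** * Successive approximation of the normal form *)

Section NormalForm.

Variables (K : fieldType) (n : nat) (p : 'I_n -> nat).
Hypothesis char0 : forall k, k.+1%:R != 0 :> K.
Hypothesis p_gt0 : forall i, (0 < p i)%N.
Variable M : set (vfield K n).
Hypotheses (sM : submodule M) (grM : graded p M) (adM : ad_stable p M).
Variables (X X0 : vfield K n) (d : int).
Hypotheses (MX : M X) (X0_init : initial_part p d X0 X).
Variable W : set (vfield K n).
Hypothesis W_compl : graded_complement p M (A1 M X0) W.

Let lM : linear_set M := subspace_linear (submodule_subspace sM).

Lemma initial_qhom : vsupp p (pred1 d) X0.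
Proof. exact/(qhomP p char0)/(proj1 X0_init). Qed.

Lemma initial_vord : vord p d X0.
Proof. by apply: vsuppW initial_qhom => k /= /eqP->. Qed.

Lemma initial_rest : vord p (d + 1) (X - X0).
Proof.
move=> i m; apply: contraNT; rewrite -ltNge => lt.
have := proj2 X0_init (wt p m - (p i)%:Z); rewrite -ltzD1 => /(_ lt).
move/(congr1 (fun V : vfield K n => V i 0 m)); rewrite qpartE eqxx => ->.
by rewrite mxE coef_fps0.
Qed.

Lemma vord_X : vord p d X.
Proof.
rewrite -[X](subrK X0); apply: vsuppD initial_vord.
by apply: vordW initial_rest; lia.
Qed.

Lemma initial_mem : M X0.
Proof.
have <- : qpart p d X = X0; last exact: (grM X).1.
rewrite -[X](subrK X0) qpartD (qpart_ord _ initial_rest) ?add0r; last by rewrite ltrDl.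
exact: qpart_id initial_qhom.
Qed.

Lemma W_linear : linear_set W.
Proof. by case: W_compl => sW _ _ _; apply: subspace_linear. Qed.

Lemma W_graded : graded p W.
Proof. by case: W_compl. Qed.

Lemma W_sub Y : W Y -> M Y.
Proof.
case: W_compl => _ _ _ <- WY; exists 0; last by exists Y; rewrite ?add0r.
exists 0; last by exists 0; rewrite ?scale0r ?addr0.
by exists 0; [case: lM|rewrite lie0r].
Qed.

Lemma W_decomp V : M V -> exists B f Y, [/\ M B, W Y & V = lie X0 B + f *: X0 + Y].
Proof.
move=> MV; have [_ _ _ WE] := W_compl; move: MV; rewrite -{1}WE.
move=> [_ [_ [B MB <-] [f _ <-]]] [Y WY <-].
by exists B, f, Y; split.
Qed.

(** Triples (Z, u, Y). *)
Definition state : Type := vfield K n * fps K n * vfield K n.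
Implicit Type s : state.

Definition defect s := vexp p s.1.1 X - s.1.2 *: (X0 + s.2).

(** The conditions on the three components survive the limit: positive order of Z makes its flow a
    diffeomorphism, and that of u - 1 makes u a unit. *)
Definition approx (k : nat) s :=
  [/\ M s.1.1 /\ vord p 1 s.1.1, ford p 1 (s.1.2 - 1),
      W s.2 /\ vord p (d + 1) s.2 & vord p (d + k%:Z + 1) (defect s)].

Definition close (k : nat) s s' :=
  [/\ vord p (1 + k%:Z) (s'.1.1 - s.1.1), ford p (1 + k%:Z) (s'.1.2 - s.1.2) &
      vord p (d + 1 + k%:Z) (s'.2 - s.2)].

Lemma approx0 : approx 0 (0, 1, 0).
Proof.
case: W_linear => W0 _ _; case: lM => M0 _ _; split => /=.
- by split=> //; apply: vsupp0.
- by rewrite subrr; apply: fsupp0.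
- by split=> //; apply: vsupp0.
rewrite /defect /= addr0 scale1r addr0 -[vexp p 0 X](subrK X) -addrA.
apply: vsuppD initial_rest; apply: vexp_approx vord_X; exact: vsupp0.
Qed.

Lemma approx_step k s : approx k s -> exists s', approx k.+1 s' /\ close k s s'.
Proof.
case: s => [[Z u] Y] [/= [MZ Z1] u1 [WY Y1]]; rewrite /defect /=.
set R := vexp p Z X - u *: (X0 + Y) => Rk.
have [M0 MD MC] := lM; have MN V := linear_set_opp lM (V := V).
have [W0 WD WC] := W_linear.
have MR : M R.
  apply: (MD); first exact: (vexp_stable char0).
  apply: (MN); rewrite -[_ *: _]addr0; apply: (proj2 sM) => //.
  by apply: (MD); [exact: initial_mem|exact: W_sub].
have [B [f [w [MB Ww RE]]]] := W_decomp MR.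
(* The defect has order at least [d + c]; its part of degree [d + c] is the one to remove. *)
pose c := k%:Z + 1.
pose zeta := qpart p c B; pose g := fpart p c f; pose y := qpart p (d + c) w.
(* Since [X0] is homogeneous, taking parts passes inside the bracket and the multiple of [X0]. *)
have rE : qpart p (d + c) R = lie X0 zeta + g *: X0 + y.
  rewrite RE 2!qpartD (qpart_lie _ _ initial_qhom) (qpartZ _ _ initial_qhom) //.
have zc : vord p c zeta by apply: vsuppW (@vsupp_qpart _ _ p c B) => a /= /eqP->.
have gc : ford p c g by apply: fsuppW (@fsupp_fpart _ _ p c f) => a /= /eqP->.
have yc : vord p (d + c) y.
  by apply: vsuppW (@vsupp_qpart _ _ p (d + c) w) => a /= /eqP->.
have Mz : M zeta by exact: (grM B).1.
have Wy : W y by exact: (W_graded w).1.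
clearbody zeta g y.
have Z'1 : vord p 1 (Z + zeta).
  by apply: vsuppD => //; apply: vordW zc; rewrite /c; lia.
have u'1 : ford p 1 (u + g - 1).
  by rewrite addrAC; apply: fsuppD => //; apply: fordW gc; rewrite /c; lia.
have Zz : Z + zeta - Z = zeta by rewrite addrAC subrr add0r.
exists (Z + zeta, u + g, Y + y); split; last first.
  split; rewrite /= [_ + _ - _]addrAC subrr add0r.
  - by rewrite addrC.
  - by rewrite addrC.
  - by rewrite -addrA [1 + _]addrC.
split; cbn [fst snd].
- by split; [apply: (MD)|].
- exact: u'1.
- split; first exact: WD.
  by apply: vsuppD => //; apply: vordW yc; rewrite /c; lia.
rewrite /defect; cbn [fst snd].
(* Each of the five terms has order at least d + k + 2: the rest of the old defect, the nonlinear
   error, [zeta, X - X_0], and the two products. *)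
have -> : vexp p (Z + zeta) X - (u + g) *: (X0 + (Y + y)) =
    (R - qpart p (d + c) R) + (vexp p (Z + zeta) X - vexp p Z X - lie zeta X)
    + lie zeta (X - X0) - g *: Y - (u + g - 1) *: y.
  by rewrite rE (lieBr zeta X X0) (lieC X0 zeta); exact: step_identity.
have le2 : d + k.+1%:Z + 1 <= d + k%:Z + 2 by lia.
apply: vsuppB; [apply: vsuppB; [apply: vsuppD; [apply: vsuppD|]|]|].
- have -> : d + k.+1%:Z + 1 = d + c + 1 by rewrite /c; lia.
  by apply: vord_qpart_step; rewrite addrA.
- apply: (vordW le2); rewrite -{2}Zz.
  by apply: vexp_perturb vord_X => //; rewrite Zz.
- by apply: vordW (vord_lie zc initial_rest); rewrite /c; lia.
- by apply: vordW (vordZ gc Y1); rewrite /c; lia.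
- by apply: vordW (vordZ u'1 yc); rewrite /c; lia.
Qed.

Lemma approx_seq : exists s : nat -> state,
  forall k, approx k (s k) /\ close k (s k) (s k.+1).
Proof.
(* The implication inside the existential makes the successor total, as choice requires. *)
have /choice[F FP] (x : nat * state) :
    exists s', approx x.1 x.2 -> approx x.1.+1 s' /\ close x.1 x.2 s'.
  have [/approx_step[s' sP]|nap] := pselect (approx x.1 x.2); first by exists s'.
  by exists x.2.
pose s := fix s k := if k is j.+1 then F (j, s j) else (0, 1, 0).
have ap k : approx k (s k).
  by elim: k => [|k IH]; [exact: approx0|case: (FP (k, s k) IH)].
by exists s => k; split=> //; case: (FP (k, s k) (ap k)).
Qed.

Lemma formal_normal_form : exists (Y Phi : vfield K n) (u : fps K n),
  [/\ W Y, formal_diffeo Phi, formal_unit u & pullback Phi X = u *: (X0 + Y)].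
Proof.
have [s sP] := approx_seq.
have [Z Zlim] : exists Z, forall k : nat, vord p (1 + k%:Z) (Z - (s k).1.1).
  by apply: (vord_limit (s := fun k => (s k).1.1)) => k; case: (sP k) => _ [].
have [u ulim] : exists u, forall k : nat, ford p (1 + k%:Z) (u - (s k).1.2).
  by apply: (ford_limit (s := fun k => (s k).1.2)) => k; case: (sP k) => _ [].
have [Y Ylim] : exists Y, forall k : nat, vord p (d + 1 + k%:Z) (Y - (s k).2).
  by apply: (vord_limit (s := fun k => (s k).2)) => k; case: (sP k) => _ [].
have Z1 : vord p 1 Z.
  rewrite -[Z](subrK (s 0).1.1); apply: vsuppD (Zlim 0) _.
  by case: (sP 0) => -[[]].
have u1 : ford p 1 (u - 1).
  rewrite -[u](subrK (s 0).1.2) -addrA; apply: fsuppD (ulim 0) _.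
  by case: (sP 0) => -[].
have Y1 : vord p (d + 1) Y.
  rewrite -[Y](subrK (s 0).2); apply: vsuppD.
    by apply: vordW (Ylim 0); lia.
  by case: (sP 0) => -[_ _ []].
exists Y, (flow p Z), u; split.
- apply: (graded_lim (s := fun k => (s k).2) W_graded _ Ylim) => k.
  by case: (sP k) => -[_ _ []].
- exact: flow_diffeo.
- have -> : u = 1 + (u - 1) by rewrite addrCA subrr addr0.
  rewrite /formal_unit coef_fpsD coef_fps1 eqxx.
  have -> : (u - 1) 0%MM = 0.
    by apply/eqP/negPn/negP => /u1; rewrite wt0.
  by rewrite addr0 oner_neq0.
rewrite (pullback_flow char0) //; apply/eqP; rewrite -subr_eq0; apply/eqP.
(* The difference is shown to vanish modulo every order [N], by comparison with an approximation
   whose index [k] satisfies d + k >= N. *)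
apply: (@vord_eq0 _ _ p) => N; pose k := absz (N - d)%R.
apply: (@vordW _ _ p (d + 1 + k%:Z)); first by rewrite /k; lia.
case: (sP k) => -[[_ Zk1] uk1 [_ Yk1] def] _.
rewrite (limit_identity (vexp p (s k).1.1 X) _ _ (s k).2 _
  (lie (Z - (s k).1.1) X) (s k).1.2).
apply: vsuppB; [apply: vsuppB; [apply: vsuppD; [apply: vsuppD|]|]|].
- apply: (@vordW _ _ p (d + k%:Z + 2)); first lia.
  by apply: vexp_perturb vord_X => //; rewrite addrC.
- by apply: vordW (vord_lie (Zlim k) vord_X); lia.
- by apply: vordW def; lia.
- apply: (@vordW _ _ p (1 + k%:Z + d)); first lia.
  apply: vordZ => //; apply: vsuppD initial_vord _.
  by apply: vordW Y1; lia.
- apply: (@vordW _ _ p (0 + (d + 1 + k%:Z))); first lia.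
  by apply: vordZ (Ylim k); apply: ford_ge0.
Qed.

End NormalForm.

(** * Specialization to complex coefficients *)

Local Open Scope complex_scope.

Theorem mainTheorem2 (R : realType) (n : nat) (p : 'I_n -> nat)
    (p_gt0 : forall i, (0 < p i)%N)
    (p_coprime : \big[gcdn/0%N]_(i < n) p i = 1%N)
    (M : set (vfield R[i] n))
    (M_submodule : submodule M) (M_graded : graded p M)
    (M_ad : ad_stable p M)
    (X X0 : vfield R[i] n) (delta0 : int)
    (XM : M X) (X0_init : initial_part p delta0 X0 X)
    (W : set (vfield R[i] n))
    (W_compl : graded_complement p M (A1 M X0) W) :
  exists (Y Phi : vfield R[i] n) (u : fps R[i] n),
    [/\ W Y, formal_diffeo Phi, formal_unit u &
        pullback Phi X = u *: (X0 + Y)].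
Proof.
have char0 k : k.+1%:R != 0 :> R[i] by rewrite pnatr_eq0.
exact: (formal_normal_form char0 p_gt0 M_submodule M_graded M_ad XM X0_init W_compl).
Qed.
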